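(* Let $A_1$, $\vec b_1$, $C$, $J_1,\dots,J_{I_P}$ be the matrices, right-hand side and discrete area functionals of the charge simulation scheme described in the context, and assume the non-degeneracy condition $\operatorname{rank}C=I_P-1$. Let $P=I-C^\top(CC^\top)^{-1}C$, and let $\vec q=P\vec y_k$, where $\vec y_k$ is any iterate ($k\ge0$) of the conjugate-gradient least-squares (CGLS) iteration with zero initial guess applied to the projected problem $$\min_{\vec y\in\mathbb{R}^{n}}\|A_1P\vec y-\vec b_1\|_2^2 ;$$ in particular $\vec q$ may be the computed solution, whatever the truncation index, the stopping tolerance, or the size of the residual $\|A_1\vec q-\vec b_1\|_2$. Then, in exact arithmetic, $$J_p(\vec q)=0\qquad\text{for all } p=1,\dots,I_P,$$ i.e. the reconstructed normal velocity field has exactly zero net flux through the boundary of every phase, including the unbounded phase $p=I_P$ (for which no row of $C$ is assembled).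
   Context: Combinatorics. $\mathbb{N}_{\le K}=\{1,\dots,K\}$. Fix $I_P\ge2$ phases, $I_R\ge2$ regions, $I_S\ge1$ curves. A surjective map $\mathscr{R}_p:\mathbb{N}_{\le I_R}\to\mathbb{N}_{\le I_P}$ (the subscript $p$ is part of the symbol) assigns each region to its phase, with $\mathscr{R}_p(I_R)=I_P$, region $I_R$ being the unbounded one. Each curve $i$ separates exactly two regions $r_i^-,r_i^+$, with phases $p_i^\pm=\mathscr{R}_p(r_i^\pm)$ and $p_i^-\ne p_i^+$. Write $\mathscr{C}_r^{-1}(r)=\{i: r\in\{r_i^-,r_i^+\}\}$ for the curves bounding region $r$, and $o_{r,i}=+1$ if $r=r_i^-$, $o_{r,i}=-1$ if $r=r_i^+$. Polygonal network. Curve $i$ is an oriented polygonal curve $\Gamma_i^h$ in $\mathbb{R}^2$ with vertices $\vec X_{i,1},\dots,\vec X_{i,N_i}$; if closed, $\vec X_{i,0}=\vec X_{i,N_i}$ and its edges are indexed by $E_i=\{1,\dots,N_i\}$; if open, its edges are indexed by $E_i=\{2,\dots,N_i\}$. Edge $j$ joins $\vec X_{i,j-1}$ to $\vec X_{i,j}$, has length $r_{i,j}>0$, midpoint $\vec X^*_{i,j}$ and unit normal $\vec\nu^h_{i,j}=(\vec X_{i,j}-\vec X_{i,j-1})^\perp/r_{i,j}$, with $\perp$ the clockwise rotation by $90^\circ$; it points from region $r_i^-$ to region $r_i^+$. The network splits the plane into the polygonal regions $\Omega^h_1,\dots,\Omega^h_{I_R}$. $\varsigma_i$ is the (constant) surface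 tension of curve $i$. $\phi_{i,j}$ is the outer (turning) angle at $\vec X_{i,j}$, positive for counter-clockwise turning, and the discrete curvature on edge $j$ is $\kappa^h_{i,j}=\{\tan(\phi_{i,j-1}/2)+\tan(\phi_{i,j}/2)\}/r_{i,j}$, except that on an open curve, with $N=N_i$ and $\ell_j=r_{i,j}$, it is replaced near the endpoints by $\kappa^h_{i,2}=\frac{\phi_{i,2}}{(\ell_2+\ell_3)/2}$, $\kappa^h_{i,3}=\frac{\phi_{i,2}+\phi_{i,3}}{\ell_2/2+\ell_3+\ell_4/2}$, $\kappa^h_{i,N}=\frac{\phi_{i,N-1}}{(\ell_{N-1}+\ell_N)/2}$, $\kappa^h_{i,N-1}=\frac{\phi_{i,N-2}+\phi_{i,N-1}}{\ell_{N-2}/2+\ell_{N-1}+\ell_N/2}$. Charge simulation ansatz. $\Phi(\vec x)=\frac1{2\pi}\log|\vec x|$. Let $M_r=\sum_{i\in\mathscr{C}_r^{-1}(r)}\#E_i$. The charge points of region $r$ are $\vec y^{(r)}_{i,j}=\vec X^*_{i,j}+M_r^{-1/2}o_{r,i}\vec\nu^h_{i,j}$ and $\vec z^{(r)}_{i,j}=\vec X^*_{i,j}+M_r^{3/2}o_{r,i}\vec\nu^h_{i,j}$ (when $\partial\Omega^h_r$ has several connected components, they are placed component by component), and lie outside $\Omega_r^h$ and off the collocation points $\vec X^*_{i,j}$ of $\partial\Omega_r^h$. For each region $r$ and phase $p$, $$w^{(r)}_p(\vec x)=c^{(r)}_p+\sum_{i\in\mathscr{C}_r^{-1}(r)}\sum_{j\in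 E_i}Q^{(r)}_{p,(i,j)}\{\Phi(\vec x-\vec y^{(r)}_{i,j})-\Phi(\vec x-\vec z^{(r)}_{i,j})\}.$$ The unknown vector $\vec q\in\mathbb{R}^n$ collects all real coefficients $c^{(r)}_p$, $Q^{(r)}_{p,(i,j)}$ for $1\le p\le I_P-1$, so $n=(I_P-1)\sum_{r=1}^{I_R}(M_r+1)$; the coefficients for $p=I_P$ are defined by the zero-sum condition $c^{(r)}_{I_P}=-\sum_{p<I_P}c^{(r)}_p$, $Q^{(r)}_{I_P,(i,j)}=-\sum_{p<I_P}Q^{(r)}_{p,(i,j)}$. Linear system. $A_1\vec q=\vec b_1$ consists of the following rows. - Gibbs--Thomson rows: for every curve $i$, every $k\in E_i$ and each side $r\in\{r_i^-,r_i^+\}$, $w^{(r)}_{p_i^-}(\vec X^*_{i,k})-w^{(r)}_{p_i^+}(\vec X^*_{i,k})=\varsigma_i\kappa^h_{i,k}$. - Continuity rows: for every $i$, $k\in E_i$, $1\le p\le I_P-1$, $w_p^{(r_i^+)}(\vec X^*_{i,k})-w_p^{(r_i^-)}(\vec X^*_{i,k})=0$. The normal velocity at edge $(i,j)$ is the linear functional $$v_{i,j}(\vec q)=\bigl(\nabla w^{(r_i^+)}_{p_i^-}(\vec X^*_{i,j})-\nabla w^{(r_i^-)}_{p_i^-}(\vec X^*_{i,j})\bigr)\cdot\vec\nu^h_{i,j}.$$ For $1\le p\le I_P$ the discrete area functional is $$J_p(\vec q)=\sum_{r\in\mathscr{R}_p^{-1}(p)}\ \sum_{i\in\mathscr{C}_r^{-1}(r)}o_{r,i}\sum_{j\in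 E_i}r_{i,j}\,v_{i,j}(\vec q).$$ $C$ is the $(I_P-1)\times n$ matrix whose $p$-th row represents $-J_p$, $1\le p\le I_P-1$. CGLS with zero initial guess for $\min_{\vec y}\|B\vec y-\vec b\|_2^2$ (here $B=A_1P$, $\vec b=\vec b_1$): $\vec y_0=\vec0$, $\vec\rho_0=\vec b$, $\vec s_0=\vec d_0=B^\top\vec\rho_0$; and while $\vec s_k\ne\vec 0$: $\alpha_k=\|\vec s_k\|^2/\|B\vec d_k\|^2$, $\vec y_{k+1}=\vec y_k+\alpha_k\vec d_k$, $\vec\rho_{k+1}=\vec\rho_k-\alpha_kB\vec d_k$, $\vec s_{k+1}=B^\top\vec\rho_{k+1}$, $\vec d_{k+1}=\vec s_{k+1}+(\|\vec s_{k+1}\|^2/\|\vec s_k\|^2)\vec d_k$. *)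

(* Defs.v *)
From HB Require Import structures.
From mathcomp Require Import all_boot all_order all_algebra.
From mathcomp Require Import all_classical all_reals all_analysis.

Set Implicit Arguments.
Unset Strict Implicit.
Unset Printing Implicit Defensive.

Import Order.TTheory GRing.Theory Num.Theory.
Import numFieldNormedType.Exports.

Local Open Scope classical_set_scope.
Local Open Scope ring_scope.

(* The norm that the library puts on 'rV[R]_2 is the sup norm; lengths and
   the kernel Phi are Euclidean, hence [enorm]. *)
Section plane.
Variable R : realType.
Implicit Types (u v x : 'rV[R]_2) (f : 'rV[R]_2 -> R).

Definition dot u v : R := \sum_(i < 2) u 0 i * v 0 i.
Definition enorm u : R := Num.sqrt (dot u u).
Definition cross u v : R :=
  u 0 ord0 * v 0 ord_max - u 0 ord_max * v 0 ord0.

(* clockwise rotation by 90 degrees: (a, b) |-> (b, - a) *)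
Definition perp u : 'rV[R]_2 :=
  \row_(i < 2) (if i == ord0 then u 0 ord_max else - u 0 ord0).

(* signed angle from u to v, positive counter-clockwise *)
Definition signed_angle u v : R :=
  let a := acos (dot u v / (enorm u * enorm v)) in
  if 0 <= cross u v then a else - a.

Definition grad f x : 'rV[R]_2 := \row_(i < 2) 'D_(delta_mx 0 i) f x.

Definition Phi x : R := (2 * pi)^-1 * ln (enorm x).

Definition frontier (A : set 'rV[R]_2) : set 'rV[R]_2 := closure A `\` interior A.

End plane.

(* Phases, regions and curves are numbered from 0: the phase I_P and the
   region I_R are the ordinals of value IP.-1 and IR.-1. The vertices X_{i,j}
   and the edges j of the curve i keep their numbering; [vertex i j] is only
   meaningful for 1 <= j <= nvertex i on an open curve, and is periodic in j on
   a closed one. *)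
Record network (R : realType) (IP IR IS : nat) := Network {
  phase : 'I_IR -> 'I_IP;
  rminus : 'I_IS -> 'I_IR;
  rplus : 'I_IS -> 'I_IR;
  closed_curve : 'I_IS -> bool;
  nvertex : 'I_IS -> nat;
  vertex : 'I_IS -> nat -> 'rV[R]_2;
  tension : 'I_IS -> R;
  region : 'I_IR -> set 'rV[R]_2;
  (* whether the number M in the offsets M^(-1/2), M^(3/2) of the charge points
     counts the edges of one connected component of the boundary of the region,
     or those of the whole boundary; see [offset_count] *)
  by_component : bool
}.

Section scheme.
Variables (R : realType) (IP IR IS : nat) (G : network R IP IR IS).
Implicit Types (i : 'I_IS) (j : nat) (r : 'I_IR) (x : 'rV[R]_2).

Definition pminus i := phase G (rminus G i).
Definition pplus i := phase G (rplus G i).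

Definition curves_of r : {set 'I_IS} :=
  [set i | (r == rminus G i) || (r == rplus G i)].

(* only meaningful for i \in curves_of r *)
Definition orient r i : R := if r == rminus G i then 1 else -1.

Definition edges i : {set 'I_(nvertex G i).+1} :=
  [set j : 'I_(nvertex G i).+1 | ((if closed_curve G i then 1 else 2) <= j)%N].

Definition edge_vec i j : 'rV[R]_2 := vertex G i j - vertex G i j.-1.
Definition edge_len i j : R := enorm (edge_vec i j).
Definition midpoint i j : 'rV[R]_2 :=
  2^-1 *: (vertex G i j.-1 + vertex G i j).
Definition normal i j : 'rV[R]_2 := (edge_len i j)^-1 *: perp (edge_vec i j).

Definition edge_point i j (t : R) : 'rV[R]_2 :=
  (1 - t) *: vertex G i j.-1 + t *: vertex G i j.

Definition curve i : set 'rV[R]_2 :=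
  [set x | exists2 j : 'I_(nvertex G i).+1, j \in edges i &
           exists2 t : R, 0 <= t <= 1 & x = edge_point i j t].

Definition curves : set 'rV[R]_2 := \bigcup_(i in [set: 'I_IS]) curve i.

(* phi_{i,0} on a closed curve is phi_{i,N_i}, as X_{i,0} = X_{i,N_i} *)
Definition outer_angle i j : R :=
  let k := if j == 0%N then nvertex G i else j in
  signed_angle (edge_vec i k) (edge_vec i k.+1).

Definition curvature i j : R :=
  let N := nvertex G i in
  let phi := outer_angle i in
  let l := edge_len i in
  if closed_curve G i then (tan (phi j.-1 / 2) + tan (phi j / 2)) / l j
  else if j == 2%N then phi 2%N / ((l 2%N + l 3%N) / 2)
  else if j == 3%N then
    (phi 2%N + phi 3%N) / (l 2%N / 2 + l 3%N + l 4%N / 2)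
  else if j == N then phi N.-1 / ((l N.-1 + l N) / 2)
  else if j == N.-1 then
    (phi N.-2 + phi N.-1) / (l N.-2 / 2 + l N.-1 + l N / 2)
  else (tan (phi j.-1 / 2) + tan (phi j / 2)) / l j.

Definition nedges r : nat := (\sum_(i in curves_of r) #|edges i|)%N.

(* number of edges of the connected component of the boundary of the region r
   that carries the curve i *)
Definition nedges_component r i : nat :=
  (\sum_(k in curves_of r |
        `[< curve k `<=` connected_component (frontier (region G r))
                           (vertex G i (nvertex G i)) >]) #|edges k|)%N.

Definition offset_count r i : nat :=
  if by_component G then nedges_component r i else nedges r.

Definition charge_y r i j : 'rV[R]_2 :=
  midpoint i j +
  ((offset_count r i)%:R `^ (- (1 / 2)) * orient r i) *: normal i j.
Definition charge_z r i j : 'rV[R]_2 :=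
  midpoint i j +
  ((offset_count r i)%:R `^ (3 / 2) * orient r i) *: normal i j.

Definition edge_index : finType :=
  {e : {i : 'I_IS & 'I_(nvertex G i).+1} | tagged e \in edges (tag e)}.

(* pairs of a region r and an edge (i, j) of its boundary *)
Definition charge_index : finType :=
  {s : 'I_IR * edge_index | tag (val s.2) \in curves_of s.1}.

(* the unknowns c^(r)_p (inl r) and Q^(r)_{p,(i,j)} (inr (r, (i, j))), for the
   phases p other than the last one *)
Definition unknown : finType := ('I_IP.-1 * ('I_IR + charge_index))%type.

Section functionals.
Variable q : 'cV[R]_#|unknown|.

(* [u p] when p is not the last phase, minus the sum of all [u p'] otherwise *)
Definition zero_sum (u : 'I_IP.-1 -> R) (p : 'I_IP) : R :=
  if insub (val p) is Some p' then u p' else - \sum_p' u p'.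

Definition coef_c r (p : 'I_IP) : R :=
  zero_sum (fun p' => q (enum_rank ((p', inl r) : unknown)) 0) p.

Definition coef_Q (s : charge_index) (p : 'I_IP) : R :=
  zero_sum (fun p' => q (enum_rank ((p', inr s) : unknown)) 0) p.

Definition w r (p : 'I_IP) x : R :=
  coef_c r p +
  \sum_(s : charge_index | (val s).1 == r)
    let i := tag (val (val s).2) in
    let j := tagged (val (val s).2) in
    coef_Q s p * (Phi (x - charge_y r i j) - Phi (x - charge_z r i j)).

Definition velocity i j : R :=
  dot (grad (w (rplus G i) (pminus i)) (midpoint i j)
       - grad (w (rminus G i) (pminus i)) (midpoint i j))
      (normal i j).

Definition J (p : 'I_IP) : R :=
  \sum_(r | phase G r == p) \sum_(i in curves_of r)
    orient r i * \sum_(j in edges i) edge_len i j * velocity i j.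

(* the left-hand sides of the rows: (e, b) is the Gibbs--Thomson row of the edge
   e on the side r_i^+ (b = true) or r_i^- (b = false), and (e, p) is the
   continuity row of the edge e and the phase p *)
Definition row_index : finType := (edge_index * bool + edge_index * 'I_IP.-1)%type.

Definition row_lhs (t : row_index) : R :=
  match t with
  | inl (e, b) =>
      let i := tag (val e) in
      let x := midpoint i (tagged (val e)) in
      let r := if b then rplus G i else rminus G i in
      w r (pminus i) x - w r (pplus i) x
  | inr (e, p) =>
      let i := tag (val e) in
      let x := midpoint i (tagged (val e)) in
      let p' := widen_ord (leq_pred IP) p in
      w (rplus G i) p' x - w (rminus G i) p' x
  end.

End functionals.

Definition row_rhs (t : row_index) : R :=
  match t with
  | inl (e, _) =>
      let i := tag (val e) in tension G i * curvature i (tagged (val e))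
  | inr _ => 0
  end.

(* The row functionals and, on an admissible network, J p are linear in q; the
   matrix entries are their values on the canonical basis. *)
Definition matrix_A1 : 'M[R]_(#|row_index|, #|unknown|) :=
  \matrix_(t, u) row_lhs (delta_mx u 0) (enum_val t).

Definition vector_b1 : 'cV[R]_#|row_index| := \col_t row_rhs (enum_val t).

Definition matrix_C : 'M[R]_(IP.-1, #|unknown|) :=
  \matrix_(p, u) - J (delta_mx u 0) (widen_ord (leq_pred IP) p).

Definition projection : 'M[R]_#|unknown| :=
  1%:M - matrix_C^T *m invmx (matrix_C *m matrix_C^T) *m matrix_C.

Record admissible : Prop := Admissible {
  phase_surj : forall p, exists r, phase G r = p;
  phase_last : forall r, r.+1 = IR -> (phase G r).+1 = IP;
  phase_neq : forall i, pminus i != pplus i;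

  (* the end-point formulas for the curvature use r_{i,4} on an open curve *)
  nvertex_ge : forall i,
    ((if closed_curve G i then 3 else 4) <= nvertex G i)%N;
  vertex_closed : forall i j,
    closed_curve G i -> vertex G i (j + nvertex G i) = vertex G i j;
  edge_len_gt0 : forall i (j : 'I_(nvertex G i).+1),
    j \in edges i -> 0 < edge_len i j;

  region_cover : \bigcup_(r in [set: 'I_IR]) region G r = ~` curves;
  region_neq0 : forall r, region G r !=set0;
  region_disjoint : trivIset [set: 'I_IR] (region G);
  region_component : forall r x,
    region G r x -> connected_component (~` curves) x = region G r;
  region_bounded : forall r, bounded_set (region G r) <-> r.+1 <> IR;
  (* each curve has the region r_i^- on one side and r_i^+ on the other, and its
     normal points to the latter *)
  region_sides : forall i (j : 'I_(nvertex G i).+1) (t : R),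
    j \in edges i -> 0 < t < 1 ->
    \forall e \near 0^'+,
      region G (rplus G i) (edge_point i j t + e *: normal i j) /\
      region G (rminus G i) (edge_point i j t - e *: normal i j);

  charge_outside : forall r i (j : 'I_(nvertex G i).+1),
    i \in curves_of r -> j \in edges i ->
    ~ region G r (charge_y r i j) /\ ~ region G r (charge_z r i j);
  charge_off_collocation :
    forall r i (j : 'I_(nvertex G i).+1) k (l : 'I_(nvertex G k).+1),
    i \in curves_of r -> j \in edges i -> k \in curves_of r -> l \in edges k ->
    charge_y r i j <> midpoint k l /\ charge_z r i j <> midpoint k l
}.

End scheme.

Lemma card_unknown (R : realType) (IP IR IS : nat) (G : network R IP IR IS) :
  #|unknown G| = (IP.-1 * \sum_(r < IR) (nedges G r + 1))%N.
Proof.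
rewrite card_prod card_sum !card_ord big_split /= sum1_card card_ord addnC.
congr (_ * (_ + _))%N; rewrite card_sig -sum1_card.
rewrite -(pair_big_dep xpredT (fun r (e : edge_index G) => tag (val e) \in curves_of G r)
  (fun _ _ => 1%N)) /=.
apply: eq_bigr => r _; rewrite /nedges.
under [RHS]eq_bigr do rewrite -sum1_card.
rewrite (sig_big_dep (fun i => i \in curves_of G r) (fun i j => j \in edges G i)
  (fun _ _ => 1%N)) /=.
rewrite !sum1_card -(fintype.card_image val_inj); apply: eq_card => e.
apply/fintype.imageP/andP => [[f fr ->]|[er ee]]; first by split; [exact: fr|exact: (valP f)].
by exists (Sub e ee).
Qed.

Section cgls.
Variables (R : realType) (m n : nat) (B : 'M[R]_(m, n)) (b : 'cV[R]_m).

Definition sqnorm k (u : 'cV[R]_k) : R := \sum_i u i 0 ^+ 2.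

Record cgls_state := CGLSState {
  cgls_y : 'cV[R]_n;
  cgls_rho : 'cV[R]_m;
  cgls_s : 'cV[R]_n;
  cgls_d : 'cV[R]_n
}.

Definition cgls_init : cgls_state := CGLSState 0 b (B^T *m b) (B^T *m b).

Definition cgls_step (S : cgls_state) : cgls_state :=
  let: CGLSState y rho s d := S in
  if s == 0 then S else
  let alpha := sqnorm s / sqnorm (B *m d) in
  let rho' := rho - alpha *: (B *m d) in
  let s' := B^T *m rho' in
  CGLSState (y + alpha *: d) rho' s' (s' + (sqnorm s' / sqnorm s) *: d).

(* the k-th iterate; the last one is repeated once the loop has stopped *)
Definition cgls_iterate (k : nat) : 'cV[R]_n :=
  cgls_y (iter k cgls_step cgls_init).

End cgls.

(* Main.v *)
Require Import Defs.
From mathcomp Require Import all_boot all_order all_algebra.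
From mathcomp Require Import all_classical all_reals all_analysis.
Import Order.TTheory GRing.Theory Num.Theory.
Local Open Scope ring_scope.
Import numFieldNormedType.Exports.

(** The area functionals vanish on the whole range of P, and every iterate is
    mapped into this range.

    The collocation points stay away from the charge points, so that every
    potential w is differentiable there ([differentiable_w]), and the velocities,
    hence the area functionals J_p, are genuinely linear functionals of the
    coefficients ([J_linear]). For the phases p < I_P this identifies J_p with
    minus the p-th coordinate of C q ([matrix_C_mul]). A matrix C with independent
    rows has an invertible Gram matrix C C^T ([gram_unitmx]), so C P = 0
    ([mulmx_orthogonal_projection]) and J_p (P y) = 0 for these phases.

    No row of C is available for the unbounded phase. There the argument is
    geometric: each curve has one velocity and two sides of opposite orientation,
    so its flux leaves one region and enters another, and the J_p of all the
    phases add up to zero ([sum_J]). The last one therefore vanishes with the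
    others ([J_eq0]). *)

(** * Differentiability of the logarithmic potentials *)

Lemma dot_gt0 (R : realType) (x : 'rV[R]_2) : x != 0 -> 0 < dot x x.
Proof.
move=> x0; rewrite lt0r sumr_ge0 => [|i _]; last by rewrite -expr2 sqr_ge0.
rewrite andbT; apply: contraNneq x0.
move/psumr_eq0P => x0; apply/eqP/rowP => i; rewrite mxE.
have : x 0 i * x 0 i = 0 by apply: x0 => // j _; rewrite -expr2 sqr_ge0.
by move/eqP; rewrite mulf_eq0 orbb => /eqP.
Qed.

Lemma differentiable_dot (R : realType) (x : 'rV[R]_2) :
  differentiable (fun y : 'rV[R]_2 => dot y y) x.
Proof.
rewrite (_ : (fun y => _) =
    \sum_(i < 2) ((fun y : 'rV[R]_2 => y 0 i) * (fun y : 'rV[R]_2 => y 0 i))).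
  apply: differentiable_sum => i.
  by apply: differentiableM; apply: differentiable_coord.
by apply/funext => y; rewrite fct_sumE.
Qed.

(** The chain ln o sqrt o dot is smooth wherever the argument of the square root
    is positive, which for the Euclidean square means away from the origin. *)
Lemma differentiable_Phi (R : realType) (x : 'rV[R]_2) :
  x != 0 -> differentiable (@Phi R) x.
Proof.
move=> /dot_gt0 x0.
have -> : @Phi R = (2 * pi)^-1 *: (@ln R \o (Num.sqrt \o (fun y => dot y y))).
  by apply/funext.
apply: differentiableZ; apply: differentiable_comp.
  apply: differentiable_comp; first exact: differentiable_dot.
  apply/derivable1_diffP.
  by have := is_derive1_sqrt x0 => -[].
apply/derivable1_diffP; have x1 : 0 < (Num.sqrt \o (fun y => dot y y)) x.
  by rewrite /= sqrtr_gt0.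
by have := is_derive1_ln x1 => -[].
Qed.

Lemma differentiable_translate (R : realType) (V W : normedModType R)
    (f : V -> W) (c x : V) :
  differentiable f (x - c) -> differentiable (fun y => f (y - c)) x.
Proof.
by move=> df; apply: (@differentiable_comp _ _ _ _ (fun y => y - c) f).
Qed.

Lemma differentiable_bigsum (R : realType) (V W : normedModType R) (I : finType)
    (P : pred I) (f : I -> V -> W) (x : V) :
  (forall i, P i -> differentiable (f i) x) ->
  differentiable (fun y => \sum_(i | P i) f i y) x.
Proof.
move=> df; rewrite (_ : (fun y => _) = \sum_(i | P i) f i); last first.
  by apply/funext => y; rewrite fct_sumE.
by elim/big_ind: _ => // g h; apply: differentiableD.
Qed.

Lemma differentiable_potential (R : realType) (I : finType) (P : pred I)
    (c : R) (k : I -> R) (y z : I -> 'rV[R]_2) (x0 : 'rV[R]_2) :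
  (forall s, P s -> y s <> x0 /\ z s <> x0) ->
  differentiable
    (fun x => c + \sum_(s | P s) k s * (Phi (x - y s) - Phi (x - z s))) x0.
Proof.
move=> yz_x0; apply: differentiableD; first exact: differentiable_cst.
apply: differentiable_bigsum => s /yz_x0 [yx zx].
apply: differentiableZ; apply: differentiableB; apply: differentiable_translate;
  by apply: differentiable_Phi; rewrite subr_eq0; apply/eqP => /esym.
Qed.

(** * Linearity *)

Lemma dot_linearl (R : realType) (a : R) (u u' v : 'rV[R]_2) :
  dot (a *: u + u') v = a * dot u v + dot u' v.
Proof.
rewrite /dot mulr_sumr -big_split; apply: eq_bigr => i _ /=.
by rewrite !mxE mulrDl mulrA.
Qed.

(** The gradient is built from the total operator 'D, which is linear only where
    the limits exist; this is where differentiability enters. *)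
Lemma grad_linear (R : realType) (a : R) (f g : 'rV[R]_2 -> R) (x : 'rV[R]_2) :
  differentiable f x -> differentiable g x ->
  grad ((a \*: f) + g) x = a *: grad f x + grad g x.
Proof.
move=> df dg; apply/rowP => i; rewrite !mxE.
have df' := @diff_derivable _ _ _ _ _ (delta_mx 0 i) df.
have dg' := @diff_derivable _ _ _ _ _ (delta_mx 0 i) dg.
by rewrite (deriveD (derivableZ (k := a) df') dg') (deriveZ a df').
Qed.

Lemma charge_sum_linear (R : comNzRingType) (I : finType) (P : pred I)
    (a c c' : R) (k k' f : I -> R) :
  a * c + c' + \sum_(s | P s) (a * k s + k' s) * f s =
  a * (c + \sum_(s | P s) k s * f s) + (c' + \sum_(s | P s) k' s * f s).
Proof.
rewrite mulrDr addrACA mulr_sumr -big_split; congr (_ + _).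
by apply: eq_bigr => s _; rewrite mulrDl mulrA.
Qed.

Lemma scalar_delta (R : nzRingType) (n : nat) (f : 'cV[R]_n -> R) :
  (forall a q q', f (a *: q + q') = a * f q + f q') ->
  forall q, f q = \sum_u q u 0 * f (delta_mx u 0).
Proof.
move=> lf q.
have f0 : f 0 = 0.
  have := lf 1 0 0; rewrite scaler0 addr0 mul1r => f00.
  by apply: (addrI (f 0)); rewrite addr0 -f00.
have fZ a q' : f (a *: q') = a * f q' by rewrite -[_ *: _]addr0 lf f0 addr0.
have fD q' q'' : f (q' + q'') = f q' + f q''
  by rewrite -[q' in LHS]scale1r lf mul1r.
rewrite {1}[q]matrix_sum_delta.
rewrite (big_morph f fD f0); apply: eq_bigr => u _.
by rewrite big_ord1 fZ.
Qed.

(** * Projection onto the kernel of a matrix with independent rows *)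

Section gram.
Variables (R : realFieldType) (m n : nat) (C : 'M[R]_(m, n)).

(** If u C C^T = 0 then |u C|^2 = (u C) (u C)^T = 0, so u C = 0, and u = 0 because
    the rows of C are independent. *)
Lemma gram_unitmx : row_free C -> C *m C^T \in unitmx.
Proof.
move=> Cfree; rewrite -row_free_unit -kermx_eq0; apply/eqP/row_matrixP => i.
rewrite row0; set u := row i _.
have uG : u *m (C *m C^T) = 0 by apply/sub_kermxP; apply: row_sub.
apply: (row_free_inj Cfree); rewrite mul0mx.
have /matrixP/(_ 0 0) : (u *m C) *m (u *m C)^T = 0.
  by rewrite trmx_mul mulmxA -[u *m C *m _]mulmxA uG mul0mx.
rewrite mxE [RHS]mxE => sum0; apply/rowP => j; rewrite [in RHS]mxE.
have entry_ge0 l (_ : true) : 0 <= (u *m C) 0 l * (u *m C)^T l 0.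
  by rewrite [_^T _ _]mxE -expr2 sqr_ge0.
have := psumr_eq0P entry_ge0 sum0 (i := j) isT.
by rewrite [_^T _ _]mxE => /eqP; rewrite mulf_eq0 orbb => /eqP.
Qed.

Lemma mulmx_orthogonal_projection :
  row_free C -> C *m (1%:M - C^T *m invmx (C *m C^T) *m C) = 0.
Proof.
move=> /gram_unitmx Cu.
by rewrite mulmxBr mulmx1 !mulmxA mulmxV// mul1mx subrr.
Qed.

End gram.

(** * The area functionals *)

Section scheme.
Variables (R : realType) (IP IR IS : nat) (G : network R IP IR IS).
Implicit Types (q : 'cV[R]_#|unknown G|).

Lemma zero_sum_linear a (u u' : 'I_IP.-1 -> R) (p : 'I_IP) :
  zero_sum (fun p' => a * u p' + u' p') p = a * zero_sum u p + zero_sum u' p.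
Proof.
rewrite /zero_sum; case: insub => //.
by rewrite big_split -mulr_sumr opprD mulrN.
Qed.

Lemma coef_c_linear a q q' r p :
  coef_c (a *: q + q') r p = a * coef_c q r p + coef_c q' r p.
Proof.
rewrite /coef_c -zero_sum_linear; congr (zero_sum _ p).
by apply/funext => p'; rewrite !mxE.
Qed.

Lemma coef_Q_linear a q q' s p :
  coef_Q (a *: q + q') s p = a * coef_Q q s p + coef_Q q' s p.
Proof.
rewrite /coef_Q -zero_sum_linear; congr (zero_sum _ p).
by apply/funext => p'; rewrite !mxE.
Qed.

Lemma w_linear a q q' r p :
  w (a *: q + q') r p = (a \*: w q r p) + w q' r p.
Proof.
apply/funext => x; rewrite [RHS](_ : _ = a * w q r p x + w q' r p x)//.
rewrite -charge_sum_linear /w coef_c_linear; congr (_ + _).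
apply: eq_bigr => s _ /=.
by rewrite coef_Q_linear.
Qed.

Hypothesis hG : admissible G.

(** Only the charges of the region r enter [w q r], and the midpoint of an edge of
    a curve bounding r is a collocation point of that same region, which the
    charges of r avoid. *)
Lemma differentiable_w q (r : 'I_IR) p (i : 'I_IS) (j : 'I_(nvertex G i).+1) :
  i \in curves_of G r -> j \in edges G i ->
  differentiable (w q r p) (midpoint G i j).
Proof.
move=> ir ji; apply: differentiable_potential => s /eqP sr.
rewrite -sr in ir *.
exact: (charge_off_collocation hG (valP s) (valP (val s).2) ir ji).
Qed.

Lemma velocity_linear a q q' (i : 'I_IS) (j : 'I_(nvertex G i).+1) :
  j \in edges G i ->
  velocity (a *: q + q') i j = a * velocity q i j + velocity q' i j.
Proof.
move=> ji; rewrite /velocity -dot_linearl !w_linear; congr (dot _ _).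
have im : i \in curves_of G (rminus G i) by rewrite inE eqxx.
have ip : i \in curves_of G (rplus G i) by rewrite inE eqxx orbT.
have dp q'' := differentiable_w q'' _ (pminus G i) _ _ ip ji.
have dm q'' := differentiable_w q'' _ (pminus G i) _ _ im ji.
have gp := grad_linear _ a _ _ _ (dp q) (dp q').
have gm := grad_linear _ a _ _ _ (dm q) (dm q').
apply: (etrans (congr2 (fun u v => u - v) gp gm)).
have regroup (g1 g2 g3 g4 : 'rV[R]_2) :
    a *: g1 + g2 - (a *: g3 + g4) = a *: (g1 - g3) + (g2 - g4).
  by rewrite scalerBr opprD addrACA.
exact: regroup.
Qed.

Lemma J_linear p a q q' : J (a *: q + q') p = a * J q p + J q' p.
Proof.
rewrite /J mulr_sumr -big_split; apply: eq_bigr => r _ /=.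
rewrite mulr_sumr -big_split; apply: eq_bigr => i _ /=.
rewrite mulrCA -mulrDr; congr (_ * _).
rewrite mulr_sumr -big_split; apply: eq_bigr => j ji /=.
by rewrite velocity_linear// mulrDr mulrCA.
Qed.

(** The entries of C are values of J on the canonical basis, so linearity is what
    makes the product C q compute J q. *)
Lemma matrix_C_mul q (p : 'I_IP.-1) :
  (matrix_C G *m q) p 0 = - J q (widen_ord (leq_pred IP) p).
Proof.
rewrite (@scalar_delta _ _ (fun q => J q (widen_ord (leq_pred IP) p))).
  by rewrite mxE -sumrN; apply: eq_bigr => u _; rewrite mxE mulrC mulrN.
exact: J_linear.
Qed.

Lemma rminus_neq_rplus i : rminus G i != rplus G i.
Proof.
by have := phase_neq hG i; apply: contraNneq; rewrite /pminus /pplus => ->.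
Qed.

(** After the exchange of the sums over regions and curves, the flux F i of the
    curve i is counted once with sign + (from r_i^-) and once with sign - (from
    r_i^+). Both counts use the same velocity, and r_i^- <> r_i^+ because the two
    sides carry different phases. *)
Lemma sum_J q : \sum_p J q p = 0.
Proof.
pose F (i : 'I_IS) := \sum_(j in edges G i) edge_len G i j * velocity q i j.
transitivity (\sum_r \sum_(i in curves_of G r) orient G r i * F i).
  by rewrite [RHS](partition_big (phase G) xpredT).
rewrite (exchange_big_dep xpredT)//=.
apply: big1 => i _; rewrite -mulr_suml.
rewrite (bigD1 (rminus G i))/= ?inE ?eqxx//.
rewrite (bigD1 (rplus G i))/= ?inE ?eqxx ?orbT 1?eq_sym ?rminus_neq_rplus//.
rewrite big1 => [|r]; last by rewrite inE -andbA -negb_or orbC; case: orP.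
by rewrite /orient eqxx eq_sym (negPf (rminus_neq_rplus i)) addr0 subrr mul0r.
Qed.

(** The rows of C give the phases before the last one; the conservation law
    [sum_J] then leaves nothing for the last. *)
Lemma J_eq0 q : matrix_C G *m q = 0 -> forall p, J q p = 0.
Proof.
move=> Cq.
have J0 (p : 'I_IP) : (p < IP.-1)%N -> J q p = 0.
  move=> ltp; apply/eqP; rewrite -oppr_eq0; apply/eqP.
  have := matrix_C_mul q (Ordinal ltp); rewrite Cq mxE => /esym.
  by congr (- J q _ = 0); apply: val_inj.
have last_phase (p : 'I_IP) : (IP.-1 <= p)%N -> val p = IP.-1.
  move=> le_p; apply/eqP; rewrite eqn_leq le_p andbT -ltnS.
  by rewrite (ltn_predK (ltn_ord p)) ltn_ord.
move=> p; case: (ltnP p IP.-1) => [/J0//|/last_phase p_last].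
rewrite -(sum_J q) (bigD1 p)//= big1 ?addr0// => p' p'p.
case: (ltnP p' IP.-1) => [/J0//|/last_phase p'_last].
by case/eqP: p'p; apply: val_inj; rewrite p'_last.
Qed.

End scheme.

Theorem proposition8p2 (R : realType) (IP IR IS : nat)
  (hIP : (2 <= IP)%N) (hIR : (2 <= IR)%N) (hIS : (1 <= IS)%N)
  (G : network R IP IR IS) (hG : admissible G)
  (hC : \rank (matrix_C G) = IP.-1)
  (k : nat) (p : 'I_IP) :
  J (projection G *m
     cgls_iterate (matrix_A1 G *m projection G) (vector_b1 G) k) p = 0.
Proof.
apply: J_eq0 => //; rewrite mulmxA mulmx_orthogonal_projection ?mul0mx//.
by rewrite /row_free hC.
Qed.
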